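(* Let $G=(L,R,E)$ be a $d$-regular bipartite graph with bipartition $L\cup R$, and let $\lambda$ be the second largest eigenvalue of its adjacency matrix. Let $H$ be a nonempty $k$-regular induced subgraph of $G$, with $k\ge 1$. Then \[\frac{k-\lambda}{d-\lambda}\le \frac{|V(H)|}{|V(G)|}\le \frac{k+\lambda}{d+\lambda}.\]
   Context: Eigenvalues of a graph are those of its adjacency matrix, ordered $\lambda_1\ge\lambda_2\ge\cdots$; here $\lambda=\lambda_2$. An induced subgraph is $k$-regular if every vertex of it has exactly $k$ neighbours inside it.
   Formalization: The upper bound is asserted only when d+λ≠0; this excludes only G=K_2 (d=1, λ=-1), where the printed right-hand side is 0/0. When G is disconnected (λ=d), the undefined lower bound is read as 0. *)

(* Defs.v *)
From mathcomp Require Import all_boot all_order all_algebra.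
From mathcomp Require Import polyrcf.

Set Implicit Arguments.
Unset Strict Implicit.
Unset Printing Implicit Defensive.

Import Order.TTheory GRing.Theory Num.Theory.
Local Open Scope ring_scope.

Definition simple_graph (T : finType) (e : rel T) : Prop :=
  symmetric e /\ irreflexive e.

Definition bipartition (T : finType) (e : rel T) (A B : {set T}) : Prop :=
  [/\ A :|: B = setT, A :&: B = set0 &
      forall x y, e x y -> (x \in A) && (y \in B) || (x \in B) && (y \in A)].

Definition induced_regular (T : finType) (e : rel T) (S : {set T}) (k : nat)
    : Prop :=
  forall x, x \in S -> #|[set y in S | e x y]| = k.

Definition regular (T : finType) (e : rel T) (d : nat) : Prop :=
  forall x, #|[set y | e x y]| = d.

Definition adjacency (R : rcfType) (T : finType) (e : rel T) : 'M[R]_#|T| :=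
  \matrix_(i, j) (e (enum_val i) (enum_val j))%:R.

(* The eigenvalues in R in nonincreasing order, each repeated according to its
   algebraic multiplicity; see eigenvaluesE for the case of a split
   characteristic polynomial, which covers all symmetric matrices. *)
Definition eigenvalues (R : rcfType) (n : nat) (A : 'M[R]_n) : seq R :=
  sort (fun x y => y <= x)
    (flatten [seq nseq (mup x (char_poly A)) x | x <- rootsR (char_poly A)]).

Lemma eigenvaluesE (R : rcfType) (n : nat) (A : 'M[R]_n) (s : seq R) :
  char_poly A = \prod_(x <- s) ('X - x%:P) ->
  eigenvalues A = sort (fun x y => y <= x) s.
Proof.
move=> pE; have p0 : char_poly A != 0 by apply/monic_neq0/char_poly_monic.
apply/perm_sortP => [x y|y x z yx zy|x y|].
- exact: le_total.
- exact: le_trans zy yx.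
- by rewrite andbC => /le_anti.
apply/allP => x _ /=; rewrite eq_sym -mu_prod_XsubC -pE.
rewrite count_flatten -map_comp.
rewrite sumnE big_map (eq_bigr (fun y => (y == x) * mup y (char_poly A))%N);
  last by move=> y _ /=; rewrite count_nseq.
have [xr|xNr] := boolP (x \in rootsR (char_poly A)).
  rewrite (bigD1_seq x) ?uniq_roots //= eqxx mul1n big1 ?addn0 // => y /negPf ->.
  by rewrite mul0n.
rewrite big_seq big1 => [|y yr]; last first.
  by case: eqP yr => [->|_ _]; rewrite ?mul0n // (negPf xNr).
by rewrite mupNroot //; move: xNr; rewrite -roots_on_rootsR // in_itv.
Qed.

(* Numbering starts at 0, so index 1 is the second largest eigenvalue. *)
Definition second_eigenvalue (R : rcfType) (T : finType) (e : rel T) : R :=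
  (eigenvalues (adjacency R e))`_1.

(* Main.v *)
(* Let c = |S| / |T| and f = 1_S - c.  Then f is orthogonal to the constants,
   so its quadratic form |S| (k - d c) is at most lambda |f|^2 =
   lambda |S| (1 - c); this is the lower bound.  Changing the sign of f on one
   side of the bipartition negates the quadratic form, and the result is still
   orthogonal to the constants because S and T are balanced between the two
   sides; this is the upper bound. *)
Require Import Defs.
From mathcomp Require Import all_boot all_order all_algebra.
From mathcomp Require Import polyrcf complex ring lra.

Set Implicit Arguments.
Unset Strict Implicit.
Unset Printing Implicit Defensive.

Import Order.TTheory GRing.Theory Num.Theory.
Local Open Scope ring_scope.

Local Notation cplx M := (map_mx (real_complex _) M).

(** * Diagonalization of real symmetric matrices *)

Lemma char_poly_similar (F : fieldType) (n : nat) (P A B : 'M[F]_n) :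
  P \in unitmx -> P *m A = B *m P -> char_poly A = char_poly B.
Proof.
move=> uP PA.
have PC : map_mx polyC P *m char_poly_mx A = char_poly_mx B *m map_mx polyC P.
  by rewrite mulmxBr mulmxBl -!map_mxM /= PA scalar_mxC.
have dP : \det (map_mx polyC P) != 0.
  by rewrite det_map_mx polyC_eq0 -unitfE.
by apply: (mulfI dP); rewrite -det_mulmx PC det_mulmx mulrC.
Qed.

(** Over [K[i]] the matrix is Hermitian, so a unitary diagonalization exists; its eigenvalues are
    real, hence [r] can be taken over [K] although [P] is complex. *)
Lemma symmetric_spectral (K : rcfType) (n : nat) (M : 'M[K]_n) :
  M^T = M ->
  exists P : 'M[K[i]]_n, exists2 r : 'rV[K]_n,
    P \is unitarymx & P *m cplx M = diag_mx (cplx r) *m P.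
Proof.
move=> sM.
have rM : cplx M \is a mxOver Num.real.
  by apply/mxOverP => i j; rewrite mxE complex_real.
have hM : cplx M \is hermsymmx.
  apply: realsym_hermsym => //; apply/is_hermitianmxP.
  by rewrite expr0 scale1r map_trmx sM map_mx_id.
exists (spectralmx (cplx M)), (map_mx (@complex.Re K) (spectral_diag (cplx M))).
  exact: spectral_unitarymx.
have -> : cplx (map_mx (@complex.Re K) (spectral_diag (cplx M))) =
    spectral_diag (cplx M).
  apply/matrixP => i j; rewrite !mxE; apply: RRe_real.
  exact/mxOverP/hermitian_spectral_diag_real.
rewrite -[RHS]mul1mx -(mulmxV (spectral_unit (cplx M))) -[RHS]mulmxA.
congr (_ *m _); rewrite mulmxA; exact/orthomx_spectralP/hermitian_normalmx.
Qed.

(** This identifies [r] with the roots counted with multiplicity, the form that [eigenvaluesE]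
    consumes. Similarity gives the identity over [K[i]], and the embedding of [K] is injective on
    polynomials. *)
Lemma symmetric_char_poly (K : rcfType) (n : nat) (M : 'M[K]_n)
    (P : 'M[K[i]]_n) (r : 'rV[K]_n) :
  P \is unitarymx -> P *m cplx M = diag_mx (cplx r) *m P ->
  char_poly M = \prod_(j < n) ('X - (r 0 j)%:P).
Proof.
move=> uP PM; apply: (map_poly_inj (real_complex K)).
rewrite map_char_poly (char_poly_similar (unitarymx_unit uP) PM).
rewrite char_poly_trig ?diag_mx_is_trig // rmorph_prod /=.
apply: eq_bigr => i _.
by rewrite rmorphB /= map_polyX map_polyC !mxE eqxx mulr1n.
Qed.

(** * The second eigenvalue as a bound on the quadratic form *)

Lemma sorted_count_gt_nth1 (K : realDomainType) (s : seq K) :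
  sorted (fun x y => y <= x) s -> (count (fun x => (s`_1 < x)%R) s <= 1)%N.
Proof.
case: s => [|a [|b t]] //=; first by rewrite addn0 leq_b1.
move=> /andP[_ bt]; rewrite ltxx add0n.
suff /eqP-> : count (fun x => b < x) t == 0 by rewrite addn0 leq_b1.
rewrite -leqn0 leqNgt -has_count -all_predC.
apply: sub_all (order_path_min _ bt) => [x /=|y x z yx zy].
  by rewrite -leNgt.
exact: le_trans zy yx.
Qed.

(** Indices of [r] match entries of [eigenvalues M] with multiplicity, so two distinct ones above
    the entry at index 1 would contradict [sorted_count_gt_nth1]. *)
Lemma eigenvalue_le_second (K : rcfType) (n : nat) (M : 'M[K]_n)
    (P : 'M[K[i]]_n) (r : 'rV[K]_n) (i j : 'I_n) :
  P \is unitarymx -> P *m cplx M = diag_mx (cplx r) *m P ->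
  (eigenvalues M)`_1 < r 0 i -> j != i -> r 0 j <= (eigenvalues M)`_1.
Proof.
move=> uP PM li ji; rewrite leNgt; apply/negP => lj.
have: (count (fun x => ((eigenvalues M)`_1 < x)%R) (eigenvalues M) <= 1)%N.
  apply: sorted_count_gt_nth1 => //; apply: sort_sorted => x y.
  by rewrite orbC le_total.
rewrite {2}(@eigenvaluesE _ _ _ [seq r 0 l | l <- enum 'I_n]); last first.
  by rewrite (symmetric_char_poly uP PM) big_map big_enum.
rewrite (permP (permEl (perm_sort _ _))) count_map leqNgt => /negP; apply.
have -> : count (preim (fun l => r 0 l) (fun x => (eigenvalues M)`_1 < x))
    (enum 'I_n) = #|[pred l | (eigenvalues M)`_1 < r 0 l]|.
  by rewrite cardE size_filter enumT.
by apply/card_gt1P; exists i, j; rewrite eq_sym.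
Qed.

Local Open Scope sesquilinear_scope.

(* If some eigenvalue r_j exceeds the second one, then r_j is the simple
   largest eigenvalue, u is a multiple of the j-th eigenvector, and g has no
   component along it. *)
Lemma second_eigenvalue_form (K : rcfType) (n : nat) (M : 'M[K]_n)
    (u g : 'rV[K]_n) (d : K) :
  M^T = M -> u *m M = d *: u -> u != 0 ->
  (forall a, eigenvalue M a -> a <= d) -> g *m u^T = 0 ->
  (g *m M *m g^T) 0 0 <= (eigenvalues M)`_1 * (g *m g^T) 0 0.
Proof.
move=> sM uM u0 Md gu; have [P [r uP PM]] := symmetric_spectral sM.
set lam := (eigenvalues M)`_1.
have PP : P^t* *m P = 1%:M by apply: mulmx1C; apply/unitarymxP.
have cplxT m p (B : 'M[K]_(m, p)) : (cplx B)^t* = cplx B^T.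
  by apply/matrixP => i j; rewrite !mxE; apply/CrealP; rewrite complex_real.
(* Coordinates of [g] and [u] in the orthonormal eigenbasis given by the rows of [P]. *)
pose c := cplx g *m P^t*; pose w := cplx u *m P^t*.
have starP m (v : 'M[K]_(m, n)) : (cplx v *m P^t*)^t* = P *m cplx v^T.
  by rewrite trmx_mul map_mxM /= trmxCK cplxT.
have gMg : cplx (g *m M *m g^T) = c *m diag_mx (cplx r) *m c^t*.
  rewrite starP /c !mulmxA -(mulmxA _ _ P) -PM mulmxA -(mulmxA _ _ P) PP.
  by rewrite mulmx1 -!map_mxM.
have gg : cplx (g *m g^T) = c *m c^t*.
  by rewrite starP /c mulmxA -(mulmxA _ _ P) PP mulmx1 map_mxM.
have cw : c *m w^t* = 0.
  by rewrite starP /c mulmxA -(mulmxA _ _ P) PP mulmx1 -map_mxM gu map_mx0.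
have wr j : w 0 j * (r 0 j)%:C%C = d%:C%C * w 0 j.
  have: w *m diag_mx (cplx r) = d%:C%C *: w.
    have -> : diag_mx (cplx r) = P *m cplx M *m P^t*.
      by rewrite PM -mulmxA (unitarymxP uP) mulmx1.
    by rewrite !mulmxA -(mulmxA _ _ P) PP mulmx1 -map_mxM uM map_mxZ -scalemxAl.
  move=> /rowP/(_ j); rewrite mul_mx_diag [RHS]mxE [in LHS]mxE.
  by rewrite [cplx r _ _]mxE.
have rd j : r 0 j <= d.
  apply: Md; rewrite eigenvalue_root_char (symmetric_char_poly uP PM).
  rewrite rootE horner_prod; apply/prodf_eq0; exists j => //.
  by rewrite hornerXsubC subrr.
have w0 : w != 0.
  apply: contraNneq u0 => w0; rewrite -(map_mx_eq0 (real_complex K)).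
  by apply/eqP; rewrite -[LHS]mulmx1 -PP mulmxA -/w w0 mul0mx.
clearbody c w.
have rc j : (r 0 j)%:C%C * `|c 0 j| ^+ 2 <= lam%:C%C * `|c 0 j| ^+ 2.
  have [rl|lr] := leP (r 0 j) lam.
    by rewrite ler_wpM2r ?exprn_ge0 ?normr_ge0 ?lecR.
  (* Here [r 0 l <= lam < r 0 j <= d], so [r 0 l] differs from [d] and [wr] forces the coordinate to
     vanish. *)
  have wj l : l != j -> w 0 l = 0.
    move=> lj; have rl := eigenvalue_le_second uP PM lr lj.
    apply/eqP; move/eqP: (wr l); rewrite mulrC -subr_eq0 -mulrBl mulf_eq0.
    rewrite subr_eq0 => /orP[/eqP/complexI rld|//].
    by have := lt_le_trans lr (rd j); rewrite -rld ltNge rl.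
  have wj0 : w 0 j != 0.
    apply: contraNneq w0 => wj0; apply/eqP/rowP => l; rewrite [RHS]mxE.
    by have [->|/wj] := eqVneq l j.
  (* Only the [j]-th term of the inner product [cw] survives, and [w 0 j] is nonzero. *)
  suff -> : c 0 j = 0 by rewrite normr0 expr0n !mulr0.
  move/matrixP/(_ 0 0): cw; rewrite !mxE (bigD1 j) //= big1 => [|l /wj wl].
    rewrite addr0 => /eqP; rewrite mulf_eq0 => /orP[/eqP//|].
    by rewrite !mxE conjC_eq0 (negPf wj0).
  by rewrite !mxE wl conjC0 mulr0.
have entry (M' : 'M[K]_1) : (M' 0 0)%:C%C = cplx M' 0 0 by rewrite mxE.
rewrite -lecR rmorphM /= !entry gMg gg mul_mx_diag !mxE mulr_sumr.
apply: ler_sum => j _; rewrite !mxE.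
by have := rc j; rewrite normCK [c 0 j * _%:C%C]mulrC -mulrA.
Qed.

(** * Quadratic form and spectrum of a regular graph *)

Definition edge_form (K : rcfType) (T : finType) (e : rel T) (f : T -> K) : K :=
  \sum_x \sum_y (e x y)%:R * (f x * f y).

Lemma sum_neighbours (K : rcfType) (T : finType) (e : rel T) (S : {set T})
    (x : T) :
  \sum_y (e x y)%:R * (y \in S)%:R = #|[set y in S | e x y]|%:R :> K.
Proof.
rewrite -sum1_card natr_sum [RHS]big_mkcond /=; apply: eq_bigr => y _.
by rewrite inE -natrM mulnb andbC; case: (_ && _).
Qed.

Lemma sum_neighboursT (K : rcfType) (T : finType) (e : rel T) (x : T) :
  \sum_y (e x y)%:R = #|[set y | e x y]|%:R :> K.
Proof.
rewrite -sum1_card natr_sum [RHS]big_mkcond /=; apply: eq_bigr => y _.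
by rewrite inE; case: (e x y).
Qed.

Lemma sum_indicator (K : rcfType) (T : finType) (S : {set T}) :
  \sum_x (x \in S)%:R = #|S|%:R :> K.
Proof.
rewrite -sum1_card natr_sum [RHS]big_mkcond.
by apply: eq_bigr => x _; case: (x \in S).
Qed.

(** At a vertex [y] where [|f|] is maximal, [|a * f y|] is at most a sum of [d] values of [|f|],
    hence at most [d * |f y|]; then [|f y| > 0] is cancelled. *)
Lemma regular_eigenvalue_le (K : rcfType) (T : finType) (e : rel T) (d : nat)
    (a : K) :
  symmetric e -> regular e d -> eigenvalue (adjacency K e) a -> a <= d%:R.
Proof.
move=> se re /eigenvalueP[v vA v0].
pose f x := v 0 (enum_rank x).
have af y : a * f y = \sum_x f x * (e x y)%:R.
  move/rowP/(_ (enum_rank y)): vA; rewrite !mxE => <-.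
  rewrite (reindex enum_rank) /=; last exact/onW_bij/enum_rank_bij.
  by apply: eq_bigr => x _; rewrite mxE !enum_rankK.
have [i vi] : exists i, v 0 i != 0.
  apply/existsP; rewrite -negb_forall; apply: contraNN v0 => /forallP vz.
  by apply/eqP/rowP => i; rewrite mxE; apply/eqP.
pose y := [arg max_(y > enum_val i) `|f y|]%O.
have ymax x : `|f x| <= `|f y|.
  by rewrite /y; case: arg_maxP => // z _; apply.
have fy : 0 < `|f y|.
  by apply: lt_le_trans (ymax (enum_val i)); rewrite normr_gt0 /f enum_valK.
rewrite -(ler_pM2r fy); apply: le_trans (_ : `|a * f y| <= _).
  by rewrite normrM ler_wpM2r ?ler_norm.
rewrite af; apply: le_trans (ler_norm_sum _ _ _) _.
rewrite -(re y) -sum_neighboursT mulr_suml; apply: ler_sum => x _.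
by rewrite normrM normr_nat mulrC se ler_wpM2l ?ler0n.
Qed.

Lemma second_eigenvalue_le (K : rcfType) (T : finType) (e : rel T) (d : nat) :
  symmetric e -> regular e d -> second_eigenvalue K e <= d%:R.
Proof.
move=> se re; rewrite /second_eigenvalue.
(* With fewer than two eigenvalues, the second one is the default 0. *)
have [lt1|] := ltnP 1 (size (eigenvalues (adjacency K e))); last first.
  by move=> /(nth_default 0) ->; rewrite ler0n.
apply: (regular_eigenvalue_le se re); rewrite eigenvalue_root_char.
have := mem_nth 0 lt1; rewrite {2}/eigenvalues mem_sort.
case/flattenP => _ /mapP[x xr ->]; rewrite mem_nseq => /andP[_ /eqP->].
by move: xr; rewrite -roots_on_rootsR ?monic_neq0 ?char_poly_monic //.
Qed.

(** The all-ones vector serves as [u] in [second_eigenvalue_form]: regularity makes it an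
    eigenvector for [d], and [x0] makes it nonzero. *)
Lemma edge_form_le (K : rcfType) (T : finType) (e : rel T) (d : nat) (x0 : T)
    (f : T -> K) :
  symmetric e -> regular e d -> \sum_x f x = 0 ->
  edge_form e f <= second_eigenvalue K e * \sum_x f x ^+ 2.
Proof.
move=> se re f0.
have sum_enum F : \sum_(i < #|T|) F (enum_val i) = \sum_x F x :> K.
  by rewrite [RHS](reindex (@enum_val T T)) //; apply/onW_bij/enum_val_bij.
pose u : 'rV[K]_#|T| := const_mx 1.
pose g : 'rV[K]_#|T| := \row_i f (enum_val i).
have := @second_eigenvalue_form K _ (adjacency K e) u g d%:R.
have -> : (g *m adjacency K e *m g^T) 0 0 = edge_form e f.
  rewrite /edge_form exchange_big mxE -sum_enum; apply: eq_bigr => j _.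
  rewrite !mxE -sum_enum mulr_suml; apply: eq_bigr => i _.
  by rewrite !mxE mulrAC mulrC.
have -> : (g *m g^T) 0 0 = \sum_x f x ^+ 2.
  by rewrite mxE -sum_enum; apply: eq_bigr => i _; rewrite !mxE expr2.
apply.
- by apply/matrixP => i j; rewrite !mxE se.
- apply/rowP => j; rewrite !mxE mulr1 -(re (enum_val j)) -sum_neighboursT.
  by rewrite -sum_enum; apply: eq_bigr => i _; rewrite !mxE mul1r se.
- apply/eqP => /rowP/(_ (enum_rank x0)); rewrite !mxE.
  exact/eqP/oner_neq0.
- by move=> a; apply: regular_eigenvalue_le.
apply/matrixP => i j; rewrite !mxE -[RHS]f0 -sum_enum.
by apply: eq_bigr => l _; rewrite !mxE mulr1.
Qed.

(** * Norm and quadratic form of the centered indicator *)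

Section CenteredIndicator.

Variables (K : rcfType) (T : finType) (e : rel T) (S : {set T}).

Let s : K := #|S|%:R.
Let n : K := #|T|%:R.

Definition centered_indicator (x : T) : K := (x \in S)%:R - s / n.

Hypothesis T0 : n != 0.

Lemma sum_centered_indicator : \sum_x centered_indicator x = 0.
Proof.
rewrite sumrB sum_indicator sumr_const -[s / n *+ _]mulr_natr.
by rewrite divfK ?subrr.
Qed.

Lemma sum_centered_indicator_sq :
  \sum_x centered_indicator x ^+ 2 = s * (1 - s / n).
Proof.
(* With [c = s / n], idempotence of [1_S] gives [f^2 = 1_S (1 - c) - c f] pointwise. *)
have -> : \sum_x centered_indicator x ^+ 2 =
    \sum_x (x \in S)%:R * (1 - s / n) - s / n * \sum_x centered_indicator x.
  rewrite mulr_sumr -sumrB; apply: eq_bigr => x _; rewrite /centered_indicator.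
  by case: (x \in S) => /=; ring.
by rewrite sum_centered_indicator mulr0 subr0 -mulr_suml sum_indicator.
Qed.

Lemma edge_form_centered_indicator (d k : nat) :
  symmetric e -> regular e d -> induced_regular e S k ->
  edge_form e centered_indicator = s * (k%:R - d%:R * (s / n)).
Proof.
move=> se re ik.
have inner x : \sum_y (e x y)%:R * centered_indicator y =
    #|[set y in S | e x y]|%:R - d%:R * (s / n).
  rewrite -sum_neighbours -(re x) -sum_neighboursT mulr_suml -sumrB.
  by apply: eq_bigr => y _; rewrite mulrBr.
(* Swapping the sums, each [f y] is counted once per neighbour, that is [d] times. *)
have inner0 : \sum_x \sum_y (e x y)%:R * centered_indicator y = 0.
  rewrite exchange_big /=; transitivity (d%:R * \sum_x centered_indicator x).
    rewrite mulr_sumr; apply: eq_bigr => y _.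
    rewrite -mulr_suml -(re y) -sum_neighboursT.
    by congr (_ * _); apply: eq_bigr => x _; rewrite se.
  by rewrite sum_centered_indicator mulr0.
(* The left factor [f x] is split as [1_S - c]; on [S] the inner sum is constant by [ik], and the
   part with [c] vanishes by [inner0]. *)
have -> : edge_form e centered_indicator =
    \sum_x (x \in S)%:R * (k%:R - d%:R * (s / n)) -
    s / n * \sum_x \sum_y (e x y)%:R * centered_indicator y.
  rewrite mulr_sumr -sumrB; apply: eq_bigr => x _.
  under eq_bigr do rewrite mulrCA.
  rewrite -mulr_sumr mulrBl inner; congr (_ - _).
  by have [/ik->|] := boolP (x \in S); rewrite ?mul0r.
by rewrite inner0 mulr0 subr0 -mulr_suml sum_indicator.
Qed.

End CenteredIndicator.

(** * Signs on the two sides of the bipartition *)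

Section BipartiteSign.

Variables (K : rcfType) (T : finType) (e : rel T) (L R : {set T}).
Hypothesis bip : bipartition e L R.

Definition side (x : T) : K := if x \in L then 1 else -1.

Lemma side_sq x : side x ^+ 2 = 1.
Proof. by rewrite /side; case: ifP; rewrite ?sqrrN expr1n. Qed.

Lemma side_edge x y : e x y -> side y = - side x.
Proof.
case: bip => _ LR bipe /bipe; rewrite /side.
have RL z : z \in R -> z \in L = false.
  by move=> zR; apply/negP => zL; have := in_set0 z; rewrite -LR inE zL zR.
by case/orP => /andP[] => [->|] /RL-> => [|->]; rewrite ?opprK.
Qed.

Lemma edge_form_side (f : T -> K) :
  edge_form e (fun x => side x * f x) = - edge_form e f.
Proof.
rewrite /edge_form -sumrN; apply: eq_bigr => x _; rewrite -sumrN.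
apply: eq_bigr => y _; have [/side_edge->|] := boolP (e x y); last first.
  by rewrite !mul0r oppr0.
by rewrite !mul1r mulrACA mulrN -expr2 side_sq mulN1r.
Qed.

(* Counting the edges of S with the sign of either endpoint gives
   k * sum = - k * sum. *)
Lemma induced_regular_balanced (S : {set T}) (k : nat) :
  symmetric e -> induced_regular e S k -> (0 < k)%N ->
  \sum_(x in S) side x = 0.
Proof.
move=> se ik k0.
have kS : k%:R * (\sum_(x in S) side x) =
    \sum_(x in S) \sum_(y in S) (e x y)%:R * side x.
  rewrite mulr_sumr; apply: eq_bigr => x xS; rewrite -(ik x xS) -mulr_suml.
  congr (_ * _); rewrite -sum_neighbours [RHS]big_mkcond; apply: eq_bigr => y _.
  by case: (y \in S); rewrite (mulr0, mulr1).
have kSN : k%:R * (\sum_(x in S) side x) = - (k%:R * (\sum_(x in S) side x)).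
  rewrite {1}kS exchange_big kS -sumrN; apply: eq_bigr => x _ /=.
  rewrite -sumrN; apply: eq_bigr => y _; rewrite se.
  by have [/side_edge->|] := boolP (e x y); rewrite ?mul0r ?oppr0 ?mulrN.
move/eqP: kSN; rewrite -addr_eq0 -mulr2n mulrn_eq0 /= mulf_eq0 pnatr_eq0.
by rewrite -leqn0 leqNgt k0 => /eqP.
Qed.

End BipartiteSign.

(** * Both bounds on the density of the subgraph *)

Theorem theorem3p2 (K : rcfType) (T : finType) (e : rel T) (L R : {set T})
    (d k : nat) (S : {set T}) :
  simple_graph e ->
  bipartition e L R ->
  regular e d ->
  S != set0 ->
  induced_regular e S k ->
  (1 <= k)%N ->
  let lambda := second_eigenvalue K e in
  (k%:R - lambda) / (d%:R - lambda) <= #|S|%:R / #|T|%:R /\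
  (d%:R + lambda != 0 ->
   #|S|%:R / #|T|%:R <= (k%:R + lambda) / (d%:R + lambda)).
Proof.
move=> [se _] bip re /set0Pn[x0 x0S] ik k1 lambda.
have n0 : 0 < #|T|%:R :> K by rewrite ltr0n; apply/card_gt0P; exists x0.
have s0 : 0 < #|S|%:R :> K by rewrite ltr0n; apply/card_gt0P; exists x0.
have nz := lt0r_neq0 n0.
have form_le := @edge_form_le K T e d x0 _ se re.
pose f := @centered_indicator K T S; pose c : K := #|S|%:R / #|T|%:R.
have fe := edge_form_centered_indicator nz se re ik.
have fs := sum_centered_indicator_sq S nz.
have lower : k%:R - d%:R * c <= lambda * (1 - c).
  have := form_le f (sum_centered_indicator S nz).
  by rewrite fe fs [_ * (_ * (1 - _))]mulrCA ler_pM2l.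
(* Viewing the whole graph as an induced regular subgraph lets the balance lemma apply to [T] as
   well as to [S]. *)
have regT : induced_regular e [set: T] d.
  by move=> x _; rewrite -(re x); apply: eq_card => y; rewrite !inE.
have d0 : (0 < d)%N.
  apply: leq_trans k1 _; rewrite -(ik x0 x0S) -(re x0); apply: subset_leq_card.
  by apply/subsetP => y; rewrite !inE => /andP[].
have sideS : \sum_x side K L x * (x \in S)%:R = 0.
  rewrite -[RHS](induced_regular_balanced K bip se ik k1) [RHS]big_mkcond.
  by apply: eq_bigr => x _; case: (x \in S); rewrite (mulr0, mulr1).
have sideT : \sum_x side K L x = 0.
  rewrite -[RHS](induced_regular_balanced K bip se regT d0).
  by apply: eq_bigl => x; rewrite inE.
have upper : d%:R * c - k%:R <= lambda * (1 - c).
  have := form_le (fun x => side K L x * f x).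
  have -> : \sum_x side K L x * f x = 0.
    under eq_bigr do rewrite mulrBr.
    by rewrite sumrB sideS -mulr_suml sideT mul0r subrr.
  rewrite (edge_form_side bip) fe.
  under eq_bigr do rewrite exprMn side_sq mul1r.
  by rewrite fs [_ * (_ * (1 - _))]mulrCA -mulrN opprB ler_pM2l //; apply.
have sum_side_sq : \sum_x side K L x ^+ 2 = #|T|%:R.
  under eq_bigr do rewrite side_sq.
  by rewrite sumr_const cardT -cardE.
(* The sign vector itself sums to 0 and has quadratic form [- d * #|T|], so testing [form_le] on it
   gives [- d <= lambda]. *)
have dl0 : 0 <= d%:R + lambda.
  have form_side : edge_form e (side K L) = - (d%:R * #|T|%:R).
    transitivity (edge_form e (fun x => side K L x * 1)).
      by apply: eq_bigr => x _; apply: eq_bigr => y _; rewrite !mulr1.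
    rewrite (edge_form_side bip) /edge_form; congr (- _).
    under eq_bigr do under eq_bigr do rewrite !mulr1.
    under eq_bigr do rewrite sum_neighboursT re.
    by rewrite sumr_const mulr_natr.
  have := form_le _ sideT; rewrite form_side sum_side_sq -mulNr ler_pM2r //.
  by rewrite -subr_ge0 opprK addrC.
have ld := second_eigenvalue_le K se re.
split.
  (* If [lambda = d], as for a disconnected graph, the quotient is 0 by convention and the bound is
     trivial. *)
  have [->|dl] := eqVneq (d%:R - lambda) 0.
    by rewrite invr0 mulr0 divr_ge0 // ltW.
  have dl1 : 0 < d%:R - lambda by rewrite lt_def dl subr_ge0.
  by rewrite ler_pdivrMr // -/c; lra.
(* The assumption [dl] excludes [lambda = - d], which occurs for a single edge; there the quotient
   would be 0 while the density is 1. *)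
move=> dl; have dl1 : 0 < d%:R + lambda by rewrite lt_def dl dl0.
by rewrite ler_pdivlMr // -/c; lra.
Qed.
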